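(* The problem of maximizing the provider's profit $P(n_0,D_{n_0})$ over all admissible dynamic lead-time quotation strategies $(n_0,D_{n_0})$ has an optimal solution $(n_P,D^{P}_{n_P})$, where $$n_P=\max(\underline{n},\min(\tilde n_P,\overline{n})),\qquad D^{P}_{n_P}=(\tilde d^{P}_{0},\ldots,\tilde d^{P}_{n_P-1},\tilde d^{P}_{n_P}+\epsilon)$$ for any $\epsilon>0$ with $\tilde d^{P}_{n_P}+\epsilon\ge 0$, and the maximum provider profit equals $$P^*=\lambda\sum_{n=0}^{n_P-1}q(n;n_P)\,G_n(\tilde d^{P}_{n}).$$
   Context: Parameters: $\lambda,\mu>0$ (arrival and service rates), $\rho=\lambda/\mu$; service value $R$, entrance fee $p$, waiting cost rate $c>0$, compensation rate $l$, risk-aversion coefficient $r>0$, with $0\le p\le R$ and $0\le l\le c$. For each integer $n\ge 0$, $X_n\sim Gamma(n+1,\mu)$ has density $\mu^{n+1}x^ne^{-\mu x}/n!$ on $(0,\infty)$. A lead-time quote is $d\in[0,\infty]$; $d=\infty$ means no compensation, with $(x-\infty)^+=0$. Expected utility of a joining customer who finds $n$ customers and is quoted $d$: $$B_n(d)=E\left[\frac{1-e^{-r(R-p-cX_n+l(X_n-d)^+)}}{r}\right]\in[-\infty,\infty).$$ The customer joins iff $B_n(d)\ge 0$. Let $L_n(d)=E(X_n-d)^+$, and let $G_n(d)=p-lL_n(d)$ if $B_n(d)\ge0$, $G_n(d)=0$ if $B_n(d)<0$ (provider's expected profit from a customer arriving at state $n$). Put $\underline n=\inf\{n\ge0:\lim_{d\to\infty}B_n(d)<0\}$,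 $\overline n=\inf\{n\ge0:B_n(0)<0\}$ (with $\inf\varnothing=\infty$), $q(n;n_0)=\rho^n/\sum_{k=0}^{n_0}\rho^k$ for $0\le n\le n_0$, and $\tilde d^P_n=\sup\{d\ge0:B_n(d)\ge0\}$ with $\sup\varnothing=-1$. An admissible dynamic quotation strategy is a pair $(n_0,D_{n_0})$ with $n_0\ge0$ a (finite) integer, $\underline n\le n_0\le\overline n$, and $D_{n_0}=(d_0,\ldots,d_{n_0})\in[0,\infty]^{n_0+1}$ such that $B_n(d_n)\ge0$ for $n=0,\ldots,n_0-1$ and $B_{n_0}(d_{n_0})<0$. Its profit per unit time is $P(n_0,D_{n_0})=\lambda\sum_{n=0}^{n_0-1}q(n;n_0)G_n(d_n)$. Finally $\tilde n_P=\min\{0\le n_0<\overline n: A(n_0)<0\}$ (with $\min\varnothing=\infty$), where $$A(n_0)=G_{n_0}(\tilde d^P_{n_0})\sum_{n=0}^{n_0}\rho^n-\rho\sum_{n=0}^{n_0-1}\rho^nG_n(\tilde d^P_n).$$ *)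

(* Defs.v *)
From mathcomp Require Import all_boot all_order all_algebra.
From mathcomp Require Import all_classical all_reals all_analysis.
Import Order.TTheory GRing.Theory Num.Theory.
Import numFieldNormedType.Exports.

Set Implicit Arguments.
Unset Strict Implicit.
Unset Printing Implicit Defensive.

Local Open Scope classical_set_scope.
Local Open Scope ring_scope.
Local Open Scope ereal_scope.

Record params (R : realType) := Params {
  arrival_rate : R;
  service_rate : R;
  service_value : R;
  entrance_fee : R;
  waiting_cost : R;
  compensation_rate : R;
  risk_aversion : R }.

(* Gamma distribution with shape n + 1 and rate mu. *)
Definition gamma_pdf {R : realType} (n : nat) (mu x : R) : R :=
  (if 0 < x then mu ^+ n.+1 * x ^+ n * expR (- mu * x) / n`!%:R else 0)%R.

Definition gamma_law {R : realType} (n : nat) (mu : R) (A : set R) : \bar R :=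
  \int[lebesgue_measure]_(x in A) (gamma_pdf n mu x)%:E.

(* (x - d)^+ for a quote d in [0, +oo], with (x - oo)^+ = 0; the value at -oo
   is irrelevant. *)
Definition delay {R : realType} (x : R) (d : \bar R) : R :=
  if d is y%:E then Num.max (x - y)%R 0%R else 0%R.

(* Infimum of a set of natural numbers, as an element of [0, +oo]; it is +oo
   for the empty set. *)
Definition enat_inf {R : realType} (S : set nat) : \bar R :=
  ereal_inf [set n%:R%:E | n in S].

Section model.
Context {disp : measure_display} {T : measurableType disp} {R : realType}.
Context (P : probability T R) (X : nat -> {RV P >-> R}) (m : params R).

Local Notation lambda := (arrival_rate m).
Local Notation mu := (service_rate m).
Local Notation v := (service_value m).
Local Notation p := (entrance_fee m).
Local Notation c := (waiting_cost m).
Local Notation l := (compensation_rate m).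
Local Notation r := (risk_aversion m).
Local Notation rho := (lambda / mu)%R.

(* When l <= c the integrand is at most 1 / r for X n >= 0, so this is
   well defined in [-oo, +oo). *)
Definition utility (n : nat) (d : \bar R) : \bar R :=
  'E_P[fun w => ((1 - expR (- r * (v - p - c * X n w + l * delay (X n w) d)))
                 / r)%R].

Definition expected_delay (n : nat) (d : \bar R) : \bar R :=
  'E_P[fun w => delay (X n w) d].

Definition gain (n : nat) (d : \bar R) : \bar R :=
  if 0 <= utility n d then p%:E - l%:E * expected_delay n d else 0.

Definition n_under : \bar R :=
  enat_inf [set n | lim (utility n x%:E @[x --> +oo%R]) < 0].

Definition n_over : \bar R := enat_inf [set n | utility n 0 < 0].

Definition q (n n0 : nat) : R :=
  (rho ^+ n / \sum_(k < n0.+1) rho ^+ k)%R.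

Definition quotes_accepted (n : nat) : set (\bar R) :=
  [set d | 0 <= d /\ 0 <= utility n d].

Definition quote_max (n : nat) : \bar R :=
  if quotes_accepted n == set0 then (-1)%:E else ereal_sup (quotes_accepted n).

Definition admissible (n0 : nat) (D : 'I_n0.+1 -> \bar R) : Prop :=
  [/\ n_under <= n0%:R%:E <= n_over,
      forall n, 0 <= D n,
      forall n : 'I_n0.+1, (n < n0)%N -> 0 <= utility n (D n)
    & utility n0 (D ord_max) < 0].

Definition profit (n0 : nat) (D : 'I_n0.+1 -> \bar R) : \bar R :=
  lambda%:E *
  \sum_(n < n0) (q n n0)%:E * gain n (D (widen_ord (leqnSn n0) n)).

Definition A (n0 : nat) : \bar R :=
  gain n0 (quote_max n0) * \sum_(n < n0.+1) (rho ^+ n)%:E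
  - rho%:E * \sum_(n < n0) (rho ^+ n)%:E * gain n (quote_max n).

Definition n_tilde : \bar R :=
  enat_inf [set n0 | n0%:R%:E < n_over /\ A n0 < 0].

Definition optimal (n0 : nat) (D : 'I_n0.+1 -> \bar R) : Prop :=
  admissible D /\
  forall (n1 : nat) (D1 : 'I_n1.+1 -> \bar R),
    admissible D1 -> profit D1 <= profit D.

Definition max_profit (z : \bar R) : Prop :=
  (exists (n0 : nat) (D : 'I_n0.+1 -> \bar R), admissible D /\ profit D = z) /\
  forall (n0 : nat) (D : 'I_n0.+1 -> \bar R), admissible D -> profit D <= z.

Definition quotes_P (n0 : nat) (eps : R) : 'I_n0.+1 -> \bar R :=
  fun n => if (n < n0)%N then quote_max n else quote_max n0 + eps%:E.

End model.

(* Main.v *)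
Require Import Defs.
From mathcomp Require Import all_boot all_order all_algebra.
From mathcomp Require Import all_classical all_reals all_analysis.
From mathcomp Require Import measurable_realfun ring lra.
Import Order.TTheory GRing.Theory Num.Theory.
Import numFieldNormedType.Exports.

Set Implicit Arguments.
Unset Strict Implicit.
Unset Printing Implicit Defensive.

Local Open Scope classical_set_scope.
Local Open Scope ring_scope.
Local Open Scope ereal_scope.

(** Why the theorem holds.

    Fix the state n.  Utility and compensation both shrink when the quote d
    grows, so among the quotes that the customer accepts the provider earns
    most with the largest one.  The largest one exists: by monotone convergence
    the utility is continuous from the left in d, including at +oo
    ([utility_ge0_limit]), so the supremum [quote_max] of the accepted quotes
    is itself accepted ([quote_max_accepted]).  For a given cutoff n0 the best
    profit is therefore lambda * [profit_rate] n0, and only the cutoff remains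
    to be chosen between [n_under] and [n_over].

    The Gamma laws increase stochastically with n, because the ratio of two
    consecutive densities is mu * x / (n + 1), which is increasing in x
    ([gamma_stochastic_order]).  Since l <= c, a longer sojourn hurts the
    customer even after compensation; so a higher state has a lower utility, a
    smaller largest quote and a longer expected delay beyond it, hence a lower
    best gain ([gain_max_nonincreasing]).

    Raising the cutoff from n0 to n0 + 1 changes the profit rate by a positive
    multiple of A(n0) ([profit_rateS]), and A(n0) itself decreases because the
    best gains do ([marginalS]).  The profit rate is thus unimodal, and peaks
    at the first n0 with A(n0) < 0, clipped to the admissible interval
    ([profit_rate_maximal]).

    It remains to see that this cutoff is finite.  [n_under] is, because the
    mean sojourn time (n + 1) / mu is unbounded and the loss of an
    uncompensated customer grows at least linearly with it.  If [n_over] is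
    infinite then l > 0, the largest quotes stay bounded, so the expected
    compensation is unbounded and the best gain becomes negative;
    since A(n) <= G_n ([marginal_le_gain]), so does A ([n_tilde_or_over_finite]). *)

(** * Densities and Gamma expectations *)

(** The density g is almost everywhere the Radon-Nikodym derivative of nu, for
    which the change of variables is known. *)
Lemma ge0_integral_density d (T : measurableType d) (R : realType)
    (nu : {finite_measure set T -> \bar R})
    (mu : {sigma_finite_measure set T -> \bar R}) (g f : T -> \bar R) :
  measurable_fun [set: T] g -> (forall x, 0 <= g x) ->
  (forall S, measurable S -> nu S = \int[mu]_(x in S) g x) ->
  measurable_fun [set: T] f -> (forall x, 0 <= f x) ->
  \int[nu]_x f x = \int[mu]_x (f x * g x).
Proof.
move=> mg g0 nuE mf f0.
have numu : nu `<< mu.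
  apply/null_content_dominatesP => S mS muS0; rewrite nuE //.
  by apply: null_set_integral => //; exact: measurable_funTS.
rewrite -(Radon_Nikodym_SigmaFinite.change_of_variables numu) //.
have h0 := Radon_Nikodym_SigmaFinite.f_ge0 numu.
have ih := Radon_Nikodym_SigmaFinite.f_integrable numu.
have mh := measurable_int _ ih.
apply: ge0_ae_eq_integral => //.
- exact: emeasurable_funM.
- exact: emeasurable_funM.
- by move=> x _; rewrite mule_ge0.
- by move=> x _; rewrite mule_ge0.
apply: ae_eqe_mul2l; apply: integral_ae_eq => // S _ mS.
by rewrite -(Radon_Nikodym_SigmaFinite.f_integral numu) // nuE.
Qed.

Lemma gamma_pdf_ge0 (R : realType) n (mu x : R) :
  (0 <= mu -> 0 <= gamma_pdf n mu x)%R.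
Proof.
move=> mu0; rewrite /gamma_pdf; case: ifPn => // x0.
by rewrite !mulr_ge0 ?invr_ge0 ?exprn_ge0 ?expR_ge0 // ltW.
Qed.

Lemma measurable_gamma_pdf (R : realType) n (mu : R) :
  measurable_fun [set: R] (gamma_pdf n mu).
Proof.
apply: measurable_fun_ifT => //.
  by apply: measurable_fun_ltr.
apply: measurable_funM => //; apply: measurable_funM.
  by apply: measurable_funM => //; exact: measurable_funX.
by apply: measurableT_comp => //; exact: measurable_funM.
Qed.

Lemma gamma_pdfS (R : realType) n (mu x : R) :
  (gamma_pdf n.+1 mu x = mu * x / n.+1%:R * gamma_pdf n mu x)%R.
Proof.
rewrite /gamma_pdf; case: ifPn => _; last by rewrite mulr0.
rewrite factS natrM invfM !exprS; ring.
Qed.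

Definition gamma_distributed d (T : measurableType d) (R : realType)
    (P : probability T R) (n : nat) (mu : R) (Y : {RV P >-> R}) :=
  forall S, measurable S -> distribution P Y S = gamma_law n mu S.

Section gamma_expectation.
Context d (T : measurableType d) (R : realType) (P : probability T R).
Context (n : nat) (mu : R) (mu_gt0 : (0 < mu)%R).

Lemma ge0_expectation_gamma k (Y : {RV P >-> R}) (f : R -> \bar R) :
  gamma_distributed k mu Y ->
  measurable_fun [set: R] f -> (forall x, 0 <= f x) ->
  \int[P]_w f (Y w) =
  \int[lebesgue_measure]_x (f x * (gamma_pdf k mu x)%:E).
Proof.
move=> Yk mf f0.
(* [lebesgue_measure] lives on [measurableTypeR R], whose display is not the one
   of R; the same function is repackaged as a variable with values there. *)
have mY : measurable_fun [set: T] (Y : T -> measurableTypeR R).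
  exact: (@measurable_funPT _ _ _ _ Y).
pose Y' : {RV P >-> measurableTypeR R} :=
  @mfun_Sub _ _ T (measurableTypeR R) Y (mem_set mY).
transitivity (\int[distribution P Y']_x f x).
  by rewrite (ge0_integral_distribution Y').
apply: ge0_integral_density => //.
- by apply/measurable_EFinP; exact: measurable_gamma_pdf.
- by move=> x; rewrite lee_fin gamma_pdf_ge0 // ltW.
Qed.

Lemma integral_gamma_pdf k (Y : {RV P >-> R}) : gamma_distributed k mu Y ->
  \int[lebesgue_measure]_x (gamma_pdf k mu x)%:E = 1.
Proof. by move=> Yk; have := Yk setT measurableT; rewrite probability_setT. Qed.

(** The densities g of order n and h of order n + 1 cross only at
    x0 = (n + 1) / mu, where h overtakes g.  So (phi x - phi x0) * (h x - g x)
    is nonnegative everywhere; as g and h have the same mass, integrating it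
    gives the claim. *)
Lemma gamma_stochastic_order (Y Z : {RV P >-> R}) (phi : R -> R) :
  gamma_distributed n mu Y -> gamma_distributed n.+1 mu Z ->
  {homo phi : x y / (x <= y)%R} -> (forall x, 0 <= phi x)%R ->
  \int[P]_w (phi (Y w))%:E <= \int[P]_w (phi (Z w))%:E.
Proof.
move=> Yn Zn phi_nd phi0.
have mphi : measurable_fun [set: measurableTypeR R] phi.
  exact: nondecreasing_measurable.
have mpdf k : measurable_fun [set: measurableTypeR R] (gamma_pdf k mu : R -> R).
  exact: measurable_gamma_pdf.
have pdf0 k x : (0 <= gamma_pdf k mu x :> R)%R by rewrite gamma_pdf_ge0 // ltW.
rewrite (ge0_expectation_gamma (f := EFin \o phi) Yn) //;
  last by apply/measurable_EFinP.
rewrite (ge0_expectation_gamma (f := EFin \o phi) Zn) //;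
  last by apply/measurable_EFinP.
pose x0 := (n.+1%:R / mu)%R.
(* The product is expanded and its negative terms are moved to the other side,
   so that only nonnegative functions are integrated: phi need not be
   integrable. *)
have cross j k : \int[lebesgue_measure]_x (gamma_pdf k mu x)%:E = 1 ->
    \int[lebesgue_measure]_x
      ((phi x * gamma_pdf j mu x)%:E + (phi x0 * gamma_pdf k mu x)%:E) =
    \int[lebesgue_measure]_x ((phi x)%:E * (gamma_pdf j mu x)%:E) +
    (phi x0)%:E.
  move=> k1; rewrite ge0_integralD //.
  - congr (_ + _); under eq_integral do rewrite EFinM.
    rewrite ge0_integralZl ?k1 ?mule1 ?lee_fin //.
    + by apply/measurable_EFinP.
    + by move=> x _; rewrite lee_fin.
  - by move=> x _; rewrite lee_fin mulr_ge0.
  - by apply/measurable_EFinP; exact: measurable_funM.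
  - by move=> x _; rewrite lee_fin mulr_ge0.
  - by apply/measurable_EFinP; exact: measurable_funM.
rewrite -(leeD2rE _ _ (fin_numE (phi x0)%:E)) //.
rewrite -(cross n _ (integral_gamma_pdf Zn)).
rewrite -(cross n.+1 _ (integral_gamma_pdf Yn)).
apply: ge0_le_integral => //.
- by move=> x _; rewrite adde_ge0 // lee_fin mulr_ge0.
- by apply: emeasurable_funD; apply/measurable_EFinP; exact: measurable_funM.
- by apply: emeasurable_funD; apply/measurable_EFinP; exact: measurable_funM.
move=> x _; rewrite -!EFinD lee_fin.
rewrite -subr_ge0.
set g := gamma_pdf n mu x; set h := gamma_pdf n.+1 mu x.
have -> : (phi x * h + phi x0 * g - (phi x * g + phi x0 * h) =
           (phi x - phi x0) * (h - g))%R by ring.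
have hE : h = (mu * x / n.+1%:R * g)%R by exact: gamma_pdfS.
have g0 : (0 <= g)%R by exact: pdf0.
have [xx0|/ltW x0x] := leP x x0.
  apply: mulr_le0; rewrite subr_le0; first exact: phi_nd.
  rewrite hE ler_piMl // ler_pdivrMr ?ltr0n // mul1r mulrC.
  by rewrite -ler_pdivlMr.
apply: mulr_ge0; rewrite subr_ge0; first exact: phi_nd.
rewrite hE ler_peMl // ler_pdivlMr ?ltr0n // mul1r mulrC.
by rewrite -ler_pdivrMr.
Qed.

(** The factor x turns the density of order n into (n + 1) / mu times the
    density of order n + 1, whose mass is 1.  The positive part agrees with the
    variable almost surely and keeps the integrand nonnegative. *)
Lemma expectation_gamma_pos (Y Z : {RV P >-> R}) :
  gamma_distributed n mu Y -> gamma_distributed n.+1 mu Z ->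
  \int[P]_w (Num.max (Y w) 0)%:E = (n.+1%:R / mu)%:E.
Proof.
move=> Yn Zn.
rewrite (ge0_expectation_gamma (f := fun x => (Num.max x 0)%:E) Yn); last 2 first.
- by apply/measurable_EFinP; exact: measurable_maxr.
- by move=> x; rewrite lee_fin le_max lexx orbT.
transitivity (\int[lebesgue_measure]_x
    ((n.+1%:R / mu)%:E * (gamma_pdf n.+1 mu x)%:E)).
  apply: eq_integral => x _; rewrite -!EFinM gamma_pdfS.
  have mu0 : mu != 0%R by rewrite gt_eqF.
  have n0 : n.+1%:R != 0%R :> R by rewrite pnatr_eq0.
  congr EFin; have [x0|x0] := ltP 0%R x.
    by field; exact/andP.
  by rewrite /gamma_pdf ltNge x0 /= !mulr0.
rewrite ge0_integralZl //.
- by rewrite (integral_gamma_pdf Zn) mule1.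
- by apply/measurable_EFinP; exact: measurable_gamma_pdf.
- by move=> x _; rewrite lee_fin gamma_pdf_ge0 // ltW.
- by rewrite lee_fin divr_ge0 ?ler0n // ltW.
Qed.

End gamma_expectation.

(** * Delays and losses *)

(** The positive part of k - g is bounded by k, hence has a finite integral, so
    the formula survives when g has an infinite one: both sides are then -oo. *)
Lemma integral_cst_sub_ge0 d (T : measurableType d) (R : realType)
    (P : probability T R) (k : R) (g : T -> R) :
  (0 <= k)%R -> measurable_fun [set: T] g -> (forall w, 0 <= g w)%R ->
  \int[P]_w (k - g w)%:E = k%:E - \int[P]_w (g w)%:E.
Proof.
move=> k0 mg g0.
pose f w := (k - g w)%:E.
have mf : measurable_fun [set: T] f.
  by apply/measurable_EFinP; exact: measurable_funB.
rewrite -/f integralE.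
set a := \int[P]_w f^\+ w; set b := \int[P]_w f^\- w; set G := \int[P]_w _.
have a0 : 0 <= a by exact: integral_ge0.
have b0 : 0 <= b by exact: integral_ge0.
have G0 : 0 <= G by apply: integral_ge0 => w _; rewrite lee_fin.
have mp : measurable_fun [set: T] f^\+ by exact: measurable_funepos.
have mn : measurable_fun [set: T] f^\- by exact: measurable_funeneg.
have mG : measurable_fun [set: T] (EFin \o g) by exact/measurable_EFinP.
have kE : \int[P]_w (cst k%:E w) = k%:E.
  by have := expectation_cst P k; rewrite unlock.
have ak : a <= k%:E.
  rewrite -kE; apply: ge0_le_integral => // w _ /=.
  by rewrite funeposE /f -EFin_max lee_fin ge_max k0 andbT gerBl.
have E : a + G = b + k%:E.
  rewrite -kE /a /G /b -!ge0_integralD //;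
    last by move=> w _; rewrite lee_fin.
  apply: eq_integral => w _.
  rewrite funeposE funenegE /f /cst -EFinN -!EFin_max -!EFinD; congr EFin.
  by have [h|h] := leP (k - g w)%R 0%R;
    have [h'|h'] := leP (- (k - g w))%R 0%R; lra.
have afin : a \is a fin_num by rewrite ge0_fin_numE // (le_lt_trans ak) // ltry.
move: a b G afin a0 b0 G0 E {mp mn mG kE ak} => [a| |] [b| |] [G| |] //= _ _ _ _.
by rewrite -!EFinD => -[E]; congr EFin; lra.
Qed.

Section delay_theory.
Context (R : realType).
Implicit Types (x y : R) (d e : \bar R).

Lemma delay_ge0 x d : (0 <= delay x d)%R.
Proof. by case: d => [d| |] //=; rewrite le_max lexx orbT. Qed.

Lemma delay_nondecreasing d : {homo (delay^~ d : R -> R) : x y / (x <= y)%R}.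
Proof.
case: d => [d| |] x y xy //=.
by rewrite ge_max !le_max lexx orbT andbT lerB // orTb.
Qed.

(** With l <= c, this bound makes the compensation grow more slowly than the
    waiting cost. *)
Lemma delay_nonexpansive d x y : (x <= y -> delay y d - delay x d <= y - x)%R.
Proof.
move=> xy; case: d => [d| |] /=; rewrite ?subrr ?subr_ge0 //.
by have [h|h] := leP (y - d)%R 0%R; have [h'|h'] := leP (x - d)%R 0%R; lra.
Qed.

Lemma delay_nonincreasing_quote x d e : d != -oo -> d <= e ->
  (delay x e <= delay x d)%R.
Proof.
move: d e => [d| |] [e| |] //= _; last by rewrite le_max lexx orbT.
by rewrite lee_fin => de; rewrite ge_max !le_max lexx orbT andbT lerB.
Qed.

Lemma delay_le_pos x d : 0 <= d -> (delay x d <= Num.max x 0)%R.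
Proof.
case: d => [d| |] //=; last by rewrite le_max lexx orbT.
by rewrite lee_fin => d0; rewrite ge_max !le_max lexx orbT andbT gerBl d0.
Qed.

Lemma measurable_delay d : measurable_fun [set: R] (delay^~ d : R -> R).
Proof. by apply: nondecreasing_measurable => //; exact: delay_nondecreasing. Qed.

End delay_theory.

Section utility_theory.
Context {disp : measure_display} {T : measurableType disp} {R : realType}.
Context (P : probability T R) (X : nat -> {RV P >-> R}) (m : params R).

Local Notation mu := (service_rate m).
Local Notation v := (service_value m).
Local Notation p := (entrance_fee m).
Local Notation c := (waiting_cost m).
Local Notation l := (compensation_rate m).
Local Notation r := (risk_aversion m).

Context (mu_gt0 : (0 < mu)%R) (c_gt0 : (0 < c)%R) (r_gt0 : (0 < r)%R).
Context (l_range : (0 <= l <= c)%R).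
Context (X_gamma : forall n, gamma_distributed n mu (X n)).

(** The utility of a customer is 1 / r minus this loss.  The loss is
    nonnegative, so its expectation always makes sense, possibly as +oo, and is
    handled by the theory of nonnegative integrals. *)
Definition loss (d : \bar R) (x : R) : R :=
  (expR (- r * (v - p - c * x + l * delay x d)) / r)%R.

Definition expected_loss (n : nat) (d : \bar R) : \bar R :=
  \int[P]_w (loss d (X n w))%:E.

Lemma loss_ge0 d x : (0 <= loss d x)%R.
Proof. by rewrite divr_ge0 ?expR_ge0 // ltW. Qed.

Lemma loss_nondecreasing d : {homo loss d : x y / (x <= y)%R}.
Proof.
move=> x y xy; have /andP[l0 lc] := l_range.
rewrite ler_pM2r ?invr_gt0 // ler_expR !mulNr lerN2 ler_pM2l //.
have h : (l * (delay y d - delay x d) <= c * (y - x))%R.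
  apply: ler_pM => //; last exact: delay_nonexpansive.
  by rewrite subr_ge0 delay_nondecreasing.
lra.
Qed.

Lemma loss_nondecreasing_quote x d e : d != -oo -> d <= e ->
  (loss d x <= loss e x)%R.
Proof.
move=> dN de; have /andP[l0 _] := l_range.
rewrite ler_pM2r ?invr_gt0 // ler_expR !mulNr lerN2 ler_pM2l // lerD2l.
by rewrite ler_wpM2l // delay_nonincreasing_quote.
Qed.

Lemma measurable_loss n d : measurable_fun [set: T] (fun w => loss d (X n w)).
Proof.
apply: (@measurableT_comp _ _ _ _ _ _ (loss d)); last exact: measurable_funPT.
by apply: nondecreasing_measurable => //; exact: loss_nondecreasing.
Qed.

Lemma utilityE n d : utility X m n d = r^-1%:E - expected_loss n d.
Proof.
rewrite /utility unlock -integral_cst_sub_ge0 ?invr_ge0 ?(ltW r_gt0) //.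
- by apply: eq_integral => w _; rewrite /loss mulrBl mul1r.
- exact: measurable_loss.
- by move=> w; exact: loss_ge0.
Qed.

Lemma utility_ge0 n d : (0 <= utility X m n d) = (expected_loss n d <= r^-1%:E).
Proof. by rewrite utilityE subre_ge0. Qed.

Lemma expected_loss_le n d e : d != -oo -> d <= e ->
  expected_loss n d <= expected_loss n e.
Proof.
move=> dN de; apply: ge0_le_integral => //.
- by move=> w _; rewrite lee_fin loss_ge0.
- by apply/measurable_EFinP; exact: measurable_loss.
- by apply/measurable_EFinP; exact: measurable_loss.
- by move=> w _; rewrite lee_fin loss_nondecreasing_quote.
Qed.

Lemma expected_lossS n d : expected_loss n d <= expected_loss n.+1 d.
Proof.
apply: (gamma_stochastic_order mu_gt0 (X_gamma n) (X_gamma n.+1)).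
- exact: loss_nondecreasing.
- exact: loss_ge0.
Qed.

Lemma expected_delay_ge0 n d : 0 <= expected_delay X n d.
Proof.
rewrite /expected_delay unlock; apply: integral_ge0 => w _.
by rewrite lee_fin delay_ge0.
Qed.

Lemma measurable_delayX n d : measurable_fun [set: T] (fun w => delay (X n w) d).
Proof.
apply: (@measurableT_comp _ _ _ _ _ _ (delay^~ d)); last exact: measurable_funPT.
exact: measurable_delay.
Qed.

Lemma expected_delay_le n d e : d != -oo -> d <= e ->
  expected_delay X n e <= expected_delay X n d.
Proof.
move=> dN de; rewrite /expected_delay unlock; apply: ge0_le_integral => //.
- by move=> w _; rewrite lee_fin delay_ge0.
- by apply/measurable_EFinP; exact: measurable_delayX.
- by apply/measurable_EFinP; exact: measurable_delayX.
- by move=> w _; rewrite lee_fin delay_nonincreasing_quote.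
Qed.

Lemma expected_delayS n d : expected_delay X n d <= expected_delay X n.+1 d.
Proof.
rewrite /expected_delay unlock.
apply: (gamma_stochastic_order (phi := delay^~ d) mu_gt0 (X_gamma n)
  (X_gamma n.+1)).
- exact: delay_nondecreasing.
- by move=> x; exact: delay_ge0.
Qed.

Lemma mean_sojourn n : \int[P]_w (Num.max (X n w) 0)%:E = (n.+1%:R / mu)%:E.
Proof. exact: (expectation_gamma_pos mu_gt0 (X_gamma n) (X_gamma n.+1)). Qed.

Lemma measurable_posX n : measurable_fun [set: T] (fun w => Num.max (X n w) 0%R).
Proof. by apply: measurable_maxr => //; exact: measurable_funPT. Qed.

Lemma expected_delay_ub n d : 0 <= d -> expected_delay X n d <= (n.+1%:R / mu)%:E.
Proof.
move=> d0; rewrite -mean_sojourn /expected_delay unlock.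
apply: ge0_le_integral => //.
- by move=> w _; rewrite lee_fin delay_ge0.
- by apply/measurable_EFinP; exact: measurable_delayX.
- by apply/measurable_EFinP; exact: measurable_posX.
- by move=> w _; rewrite lee_fin delay_le_pos.
Qed.

(** From x^+ <= (x - y)^+ + y: with a bounded quote the expected compensated
    delay grows with n as fast as the mean sojourn time. *)
Lemma expected_delay_lb n (y : R) : (0 <= y)%R ->
  (n.+1%:R / mu - y)%:E <= expected_delay X n y%:E.
Proof.
move=> y0; rewrite EFinB leeBlDr // -mean_sojourn /expected_delay unlock.
have yE : \int[P]_w (cst y%:E w) = y%:E.
  by have := expectation_cst P y; rewrite unlock.
have mD : measurable_fun [set: T] (fun w => (delay (X n w) y%:E)%:E).
  by apply/measurable_EFinP; exact: measurable_delayX.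
rewrite -[X in _ + X]yE -ge0_integralD //;
  last by move=> w _; rewrite lee_fin delay_ge0.
apply: ge0_le_integral => //.
- by move=> w _; rewrite lee_fin le_max lexx orbT.
- by apply/measurable_EFinP; exact: measurable_posX.
- exact: emeasurable_funD.
move=> w _; rewrite -EFinD lee_fin /=.
by have [h|h] := leP (X n w) 0%R; have [h'|h'] := leP (X n w - y)%R 0%R; lra.
Qed.

(** Since exp y >= 1 + y, the loss without compensation is at least
    k * x^+ with k = exp (- r (v - p)) * c, and the mean of x^+ is
    (n + 1) / mu. *)
Lemma expected_loss_unbounded :
  exists n, r^-1%:E < expected_loss n +oo.
Proof.
pose k := (expR (- r * (v - p)) * c)%R.
have k0 : (0 < k)%R by rewrite mulr_gt0 ?expR_gt0.
have lb n : (k * (n.+1%:R / mu))%:E <= expected_loss n +oo.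
  rewrite EFinM -mean_sojourn -ge0_integralZl //; last 3 first.
  - by apply/measurable_EFinP; exact: measurable_posX.
  - by move=> w _; rewrite lee_fin le_max lexx orbT.
  - by rewrite lee_fin ltW.
  apply: ge0_le_integral => //.
  - by move=> w _; rewrite -EFinM lee_fin mulr_ge0 ?(ltW k0) // le_max lexx orbT.
  - by apply/measurable_EFinP; apply: measurable_funM => //; exact: measurable_posX.
  - by apply/measurable_EFinP; exact: measurable_loss.
  move=> w _; rewrite -EFinM lee_fin.
  have [x0|x0] := leP (X n w) 0%R; first by rewrite mulr0 loss_ge0.
  rewrite /loss /= mulr0 addr0 ler_pdivlMr // mulrDr expRD /k -!mulrA.
  rewrite ler_pM2l ?expR_gt0 //.
  apply: le_trans (expR_ge1Dx _); lra.
exists (Num.truncn (r^-1 / k * mu)).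
apply: lt_le_trans (lb _); rewrite lte_fin.
rewrite mulrC -ltr_pdivrMr // ltr_pdivlMr // truncnS_gt //.
Qed.

End utility_theory.

(** * Infima of sets of naturals *)

Section enat_inf_theory.
Context (R : realType).
Implicit Types (S : set nat) (n : nat).

Lemma le_enat_inf S n :
  (enat_inf S <= n%:R%:E :> \bar R) <-> exists2 k, S k & (k <= n)%N.
Proof.
split=> [Sn|[k Sk kn]]; last first.
  apply: (@le_trans _ _ k%:R%:E); last by rewrite lee_fin ler_nat.
  by apply: ereal_inf_lbound; exists k.
apply: contrapT => noS.
suff : n.+1%:R%:E <= enat_inf S :> \bar R.
  by move=> /le_trans/(_ Sn); rewrite lee_fin ler_nat ltnn.
apply: le_ereal_inf_tmp => _ [k Sk <-]; rewrite lee_fin ler_nat ltnNge.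
by apply/negP => kn; apply: noS; exists k.
Qed.

Lemma enat_inf_attained S n : enat_inf S <= n%:R%:E :> \bar R ->
  exists2 k, S k & enat_inf S = k%:R%:E :> \bar R.
Proof.
elim: n => [|n IHn] Sn.
  have [k Sk] := (le_enat_inf S 0).1 Sn; rewrite leqn0 => /eqP k0.
  exists k => //; apply/eqP; rewrite eq_le {1}k0 Sn /=.
  by apply: le_ereal_inf_tmp => _ [j _ <-]; rewrite k0 lee_fin ler_nat.
have [/IHn//|nSn] := boolP (enat_inf S <= n%:R%:E :> \bar R).
have [k Sk kn] := (le_enat_inf S n.+1).1 Sn.
have kE : k = n.+1.
  apply/eqP; rewrite eqn_leq kn ltnNge; apply/negP => kn'.
  by move/negP: nSn; apply; apply/le_enat_inf; exists k.
exists k => //; apply/eqP; rewrite eq_le {1}kE Sn /=.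
apply: le_ereal_inf_tmp => _ [j Sj <-]; rewrite lee_fin ler_nat kE ltnNge.
by apply/negP => jn; move/negP: nSn; apply; apply/le_enat_inf; exists j.
Qed.

Lemma enat_inf_cases S :
  (exists2 k, S k & enat_inf S = k%:R%:E :> \bar R) \/ enat_inf S = +oo :> \bar R.
Proof.
have [[k Sk]|noS] := pselect (exists k, S k).
  by left; apply: (@enat_inf_attained S k); apply/le_enat_inf; exists k.
right; apply/ereal_inf_pinfty => x /= [k Sk _].
by case: noS; exists k.
Qed.

End enat_inf_theory.

(** * Continuity in the quote and the thresholds *)

Section delay_limits.
Context (R : realType).

Lemma cvg_delay_left (x y : R) :
  delay x (y - k.+1%:R^-1)%:E @[k --> \oo] --> delay x y%:E.
Proof.
apply: (@squeeze_cvgr _ _ _ _ (cst (delay x y%:E))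
  (fun k => delay x y%:E + harmonic k)%R).
- near=> k; apply/andP; split.
    by apply: delay_nonincreasing_quote => //; rewrite lee_fin gerBl.
  rewrite /harmonic /=; have := @harmonic_ge0 R k; rewrite /harmonic /= => h0.
  set e := (_^-1)%R in h0 *.
  by have [h|h] := leP (x - (y - e))%R 0%R; have [h'|h'] := leP (x - y)%R 0%R; lra.
- exact: cvg_cst.
- rewrite -[X in _ --> X]addr0; apply: cvgD; first exact: cvg_cst.
  exact: cvg_harmonic.
Unshelve. all: by end_near. Qed.

Lemma cvg_delay_pinfty (x : R) :
  delay x (k%:R)%:E @[k --> \oo] --> delay x +oo.
Proof.
apply: cvg_near_cst; near=> k; rewrite /= max_r // subr_le0.
by near: k; exact: nbhs_infty_ger.
Unshelve. all: by end_near. Qed.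

End delay_limits.

Section quote_theory.
Context {disp : measure_display} {T : measurableType disp} {R : realType}.
Context (P : probability T R) (X : nat -> {RV P >-> R}) (m : params R).

Local Notation mu := (service_rate m).
Local Notation c := (waiting_cost m).
Local Notation l := (compensation_rate m).
Local Notation r := (risk_aversion m).

Context (mu_gt0 : (0 < mu)%R) (c_gt0 : (0 < c)%R) (r_gt0 : (0 < r)%R).
Context (l_range : (0 <= l <= c)%R).
Context (X_gamma : forall n, gamma_distributed n mu (X n)).

Lemma expected_loss_limit n (u : nat -> R) (y K : \bar R) :
  nondecreasing_seq u ->
  (forall x : R, delay x (u k)%:E @[k --> \oo] --> delay x y) ->
  (forall k, expected_loss X m n (u k)%:E <= K) ->
  expected_loss X m n y <= K.
Proof.
move=> u_nd delay_u uK.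
pose g k w := (loss m (u k)%:E (X n w))%:E.
have mg k : measurable_fun [set: T] (g k).
  by apply/measurable_EFinP; exact: measurable_loss.
have g0 k w : [set: T] w -> 0 <= g k w by rewrite lee_fin loss_ge0.
have g_nd w : [set: T] w -> nondecreasing_seq (g^~ w).
  move=> _ j k jk; rewrite lee_fin loss_nondecreasing_quote //.
  by rewrite lee_fin u_nd.
have gE w : (loss m y (X n w))%:E = limn (g^~ w).
  apply/esym/cvg_lim => //; apply: cvg_EFin; first exact: nearW.
  rewrite /comp /= /loss; apply: cvgM; last exact: cvg_cst.
  apply: continuous_cvg; first exact: continuous_expR.
  apply: cvgM; first exact: cvg_cst.
  apply: cvgD; first exact: cvg_cst.
  by apply: cvgM; [exact: cvg_cst|exact: delay_u].
have cvg_g := cvg_monotone_convergence (mu := P) measurableT mg g0 g_nd.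
have -> : expected_loss X m n y = \int[P]_w limn (g^~ w).
  by apply: eq_integral => w _; rewrite gE.
by apply: (cvge_to_le cvg_g); apply: nearW => k; exact: uK.
Qed.

(** Every y > -oo is the limit of an increasing sequence of smaller reals,
    y - 1 / (k + 1) or k, along which the losses increase to the loss at y:
    monotone convergence applies even when the expected loss is infinite. *)
Lemma utility_ge0_limit n (y : \bar R) : y != -oo ->
  (forall u : R, u%:E < y -> 0 <= utility X m n u%:E) -> 0 <= utility X m n y.
Proof.
case: y => [y| |] // _ uy; rewrite utility_ge0 //.
- apply: (@expected_loss_limit n (fun k => y - k.+1%:R^-1)%R).
  + by move=> j k jk; rewrite lerB // lef_pV2 ?posrE // ler_nat.
  + by move=> x; exact: cvg_delay_left.
  + by move=> k; rewrite -utility_ge0 // uy // lte_fin gtrBl invr_gt0.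
- apply: (@expected_loss_limit n (fun k => k%:R)%R).
  + by move=> j k jk; rewrite ler_nat.
  + by move=> x; exact: cvg_delay_pinfty.
  + by move=> k; rewrite -utility_ge0 // uy // ltry.
Qed.

Lemma utility_anti_quote n d e : d != -oo -> d <= e ->
  utility X m n e <= utility X m n d.
Proof. by move=> dN de; rewrite !utilityE // leeB // expected_loss_le. Qed.

Lemma utility_anti_state n k d : (n <= k)%N ->
  utility X m k d <= utility X m n d.
Proof.
elim: k => [|k IHk]; first by rewrite leqn0 => /eqP ->.
rewrite leq_eqVlt => /predU1P[-> //|/IHk]; apply: le_trans.
by rewrite !utilityE // leeB // expected_lossS.
Qed.

(** Left-continuity at +oo turns the limit that defines [n_under] into the utility
    of a single quote, to which monotonicity in the state applies. *)
Lemma lim_utility_lt0 n :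
  (lim (utility X m n x%:E @[x --> +oo%R]) < 0) = (utility X m n +oo < 0).
Proof.
have /cvg_lim -> // : utility X m n x%:E @[x --> +oo%R] -->
    ereal_inf (range (fun x : R => utility X m n x%:E)).
  by apply: nonincreasing_cvge => x y xy; rewrite utility_anti_quote.
apply/idP/idP => [/ereal_inf_lt[_ [x _ <-]]|].
  by apply: le_lt_trans; rewrite utility_anti_quote // leey.
apply: contraTT; rewrite -!leNgt => /le_trans ge0.
apply: utility_ge0_limit => // u _; apply: ge0.
by apply: ereal_inf_lbound; exists u.
Qed.

Lemma n_under_le n : (n_under X m <= n%:R%:E) = (utility X m n +oo < 0).
Proof.
apply/idP/idP => [/le_enat_inf[k /= uk kn]|un].
  rewrite lim_utility_lt0 in uk; apply: le_lt_trans uk.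
  exact: utility_anti_state.
by apply/le_enat_inf; exists n => //=; rewrite lim_utility_lt0.
Qed.

Lemma n_over_le n : (n_over X m <= n%:R%:E) = (utility X m n 0 < 0).
Proof.
apply/idP/idP => [/le_enat_inf[k /= uk kn]|un].
  by apply: le_lt_trans uk; exact: utility_anti_state.
by apply/le_enat_inf; exists n.
Qed.

Lemma lt_n_over n : (n%:R%:E < n_over X m) = (0 <= utility X m n 0).
Proof. by rewrite ltNge n_over_le -leNgt. Qed.

Lemma n_under_attained : exists n, n_under X m = n%:R%:E.
Proof.
have [n un] := expected_loss_unbounded mu_gt0 c_gt0 r_gt0 l_range X_gamma.
have : n_under X m <= n%:R%:E by rewrite n_under_le utilityE // sube_lt0.
by move=> /enat_inf_attained[k _ kE]; exists k.
Qed.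

Lemma n_under_le_over : n_under X m <= n_over X m.
Proof.
rewrite [leRHS]/n_over.
have [[k /= uk ->]|->] := enat_inf_cases R [set n | utility X m n 0 < 0].
  by rewrite n_under_le; apply: le_lt_trans uk; rewrite utility_anti_quote.
exact: leey.
Qed.

End quote_theory.

(** * Marginal analysis of the cutoff *)

Section marginal_analysis.
Context (R : realFieldType) (rho : R) (rho_gt0 : (0 < rho)%R) (g : nat -> R).
Local Open Scope ring_scope.

Definition weight n : R := \sum_(k < n) rho ^+ k.
Definition revenue n : R := \sum_(k < n) rho ^+ k * g k.
Definition profit_rate n : R := revenue n / weight n.+1.
Definition marginal n : R := g n * weight n.+1 - rho * revenue n.

Lemma weightS n : weight n.+1 = weight n + rho ^+ n.
Proof. exact: big_ord_recr. Qed.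

Lemma revenueS n : revenue n.+1 = revenue n + rho ^+ n * g n.
Proof. exact: big_ord_recr. Qed.

Lemma weight_ge1 n : 1 <= weight n.+1.
Proof.
elim: n => [|n IHn]; first by rewrite /weight big_ord1.
by rewrite weightS (le_trans IHn) // lerDl exprn_ge0 // ltW.
Qed.

Lemma weight_gt0 n : 0 < weight n.+1.
Proof. exact: lt_le_trans ltr01 (weight_ge1 n). Qed.

(** The marginal inherits the monotonicity of g. *)
Lemma marginalS n :
  marginal n.+1 = marginal n + (g n.+1 - g n) * weight n.+2.
Proof. rewrite /marginal revenueS weightS exprS; ring. Qed.

(** The marginal is, up to a positive factor, the discrete derivative of the
    profit rate. *)
Lemma profit_rateS n : profit_rate n.+1 =
  profit_rate n + rho ^+ n * marginal n / (weight n.+1 * weight n.+2).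
Proof.
have w1 : weight n.+1 != 0 by rewrite gt_eqF // weight_gt0.
have w2 : weight n.+2 != 0 by rewrite gt_eqF // weight_gt0.
rewrite /profit_rate /marginal revenueS.
have -> : rho ^+ n * (g n * weight n.+1 - rho * revenue n) =
    (revenue n + rho ^+ n * g n) * weight n.+1 - revenue n * weight n.+2.
  by rewrite (weightS n.+1) exprS; ring.
by field; rewrite w1 w2.
Qed.

Lemma marginal_nonincreasing j n : (j <= n)%N ->
  (forall k, (j <= k < n)%N -> g k.+1 <= g k) -> marginal n <= marginal j.
Proof.
elim: n => [|n IHn]; first by rewrite leqn0 => /eqP ->.
rewrite leq_eqVlt => /predU1P[-> //|]; rewrite ltnS => jn g_ni.
apply: le_trans (IHn jn _).
  rewrite marginalS gerDl mulr_le0_ge0 ?(ltW (weight_gt0 _)) //.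
  by rewrite subr_le0 g_ni // jn leqnn.
by move=> k /andP[jk kn]; rewrite g_ni // jk ltnS ltnW.
Qed.

Lemma marginal_le_gain n :
  (forall k, (k < n)%N -> g k.+1 <= g k) -> marginal n <= g n.
Proof.
elim: n => [|n IHn] g_ni.
  by rewrite /marginal /weight /revenue big_ord1 big_ord0 mulr0 subr0 expr0 mulr1.
rewrite marginalS.
have le_n : marginal n <= g n by apply: IHn => k kn; rewrite g_ni // ltnW.
have : (g n.+1 - g n) * weight n.+2 <= (g n.+1 - g n) * 1.
  by rewrite ler_wnM2l ?weight_ge1 // subr_le0 g_ni.
by rewrite mulr1; lra.
Qed.

Lemma profit_rate_le_peak N n :
  (forall k, (n <= k < N)%N -> 0 <= marginal k) ->
  (forall k, (N <= k < n)%N -> marginal k <= 0) ->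
  profit_rate n <= profit_rate N.
Proof.
have wpos k : 0 < weight k.+1 * weight k.+2 by rewrite mulr_gt0 ?weight_gt0.
have rpos k : 0 <= rho ^+ k by rewrite exprn_ge0 // ltW.
have [nN up _|Nn _ down] := leqP n N.
  elim: N nN up => [|N IHN]; first by rewrite leqn0 => /eqP ->.
  rewrite leq_eqVlt => /predU1P[-> //|]; rewrite ltnS => nN up.
  apply: le_trans (IHN nN _) _.
    by move=> k /andP[nk kN]; rewrite up // nk ltnS ltnW.
  rewrite profit_rateS lerDl mulr_ge0 ?invr_ge0 ?(ltW (wpos _)) // mulr_ge0 //.
  by rewrite up // nN leqnn.
elim: n Nn down => // n IHn; rewrite ltnS leq_eqVlt => Nn down.
have step : profit_rate n.+1 <= profit_rate n.
  rewrite profit_rateS gerDl mulr_le0_ge0 ?invr_ge0 ?(ltW (wpos _)) //.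
  by rewrite mulr_ge0_le0 // down // leqnn andbT leq_eqVlt.
case/predU1P: Nn => [-> //|Nn]; apply: le_trans step (IHn Nn _).
by move=> k /andP[Nk kn]; rewrite down // Nk ltnS ltnW.
Qed.

End marginal_analysis.

(** * The largest accepted quote *)

Section best_quote.
Context {disp : measure_display} {T : measurableType disp} {R : realType}.
Context (P : probability T R) (X : nat -> {RV P >-> R}) (m : params R).

Local Notation mu := (service_rate m).
Local Notation p := (entrance_fee m).
Local Notation c := (waiting_cost m).
Local Notation l := (compensation_rate m).
Local Notation r := (risk_aversion m).

Context (mu_gt0 : (0 < mu)%R) (c_gt0 : (0 < c)%R) (r_gt0 : (0 < r)%R).
Context (l_range : (0 <= l <= c)%R).
Context (X_gamma : forall n, gamma_distributed n mu (X n)).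

Lemma quotes_accepted0 n : quotes_accepted X m n !=set0 -> 0 <= utility X m n 0.
Proof. by case=> d [d0 /le_trans]; apply; exact: utility_anti_quote. Qed.

Lemma quote_max_accepted n : 0 <= utility X m n 0 ->
  quotes_accepted X m n (quote_max X m n).
Proof.
move=> u0; have acc0 : quotes_accepted X m n 0 by [].
have max_ge0 : 0 <= ereal_sup (quotes_accepted X m n).
  exact: ereal_sup_ubound.
rewrite /quote_max ifF; last first.
  by apply/negbTE/set0P; exists 0.
split => //; apply: utility_ge0_limit => //.
  by rewrite gt_eqF // (lt_le_trans _ max_ge0) // ltNy0.
move=> u /ereal_sup_gt[d [d0 ud] /ltW u_le_d].
by apply: le_trans ud _; exact: utility_anti_quote.
Qed.

Lemma quote_max_ub n d : 0 <= d -> 0 <= utility X m n d -> d <= quote_max X m n.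
Proof.
move=> d0 ud; have acc : quotes_accepted X m n d by [].
rewrite /quote_max ifF; first exact: ereal_sup_ubound.
by apply/negbTE/set0P; exists d.
Qed.

(** Finiteness makes [quote_max] + eps strictly larger than [quote_max], hence a
    rejected quote. *)
Lemma quote_max_fin_num n : utility X m n +oo < 0 ->
  quote_max X m n \is a fin_num.
Proof.
move=> uy; have [u0|u0] := leP 0 (utility X m n 0).
  have [max_ge0 umax] := quote_max_accepted u0.
  rewrite ge0_fin_numE // ltey; apply/eqP => maxE.
  by move: umax; rewrite maxE leNgt uy.
rewrite /quote_max ifT //; apply/eqP; rewrite -subset0 => d [d0 ud].
by move: u0; rewrite ltNge quotes_accepted0 //; exists d.
Qed.

Lemma quote_max_nonincreasing n k : (n <= k)%N -> 0 <= utility X m k 0 ->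
  quote_max X m k <= quote_max X m n.
Proof.
move=> nk uk; have [max_ge0 umax] := quote_max_accepted uk.
by apply: quote_max_ub => //; apply: le_trans umax _; exact: utility_anti_state.
Qed.

Lemma gain_acceptedE n d : 0 <= utility X m n d ->
  gain X m n d = p%:E - l%:E * expected_delay X n d.
Proof. by rewrite /gain => ->. Qed.

Lemma expected_delay_fin_num n d : 0 <= d -> expected_delay X n d \is a fin_num.
Proof.
move=> d0; rewrite ge0_fin_numE ?expected_delay_ge0 //.
exact: le_lt_trans (expected_delay_ub mu_gt0 X_gamma n d0) (ltry _).
Qed.

Lemma gain_accepted_le n d : 0 <= d -> 0 <= utility X m n d ->
  gain X m n d <= gain X m n (quote_max X m n).
Proof.
move=> d0 ud; have /andP[l0 _] := l_range.
have [|max_ge0 umax] := @quote_max_accepted n.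
  by apply: quotes_accepted0; exists d.
rewrite !gain_acceptedE // leeB // lee_wpmul2l //.
apply: expected_delay_le; last exact: quote_max_ub.
by rewrite gt_eqF // (lt_le_trans _ d0).
Qed.

Lemma gain_max_fin_num n : 0 <= utility X m n 0 ->
  gain X m n (quote_max X m n) \is a fin_num.
Proof.
move=> /quote_max_accepted[max_ge0 umax].
by rewrite gain_acceptedE // fin_numB fin_numM //= expected_delay_fin_num.
Qed.

(** Passing from n to n + 1 lengthens the delay beyond a given quote, and
    shortens the quote itself. *)
Lemma gain_max_nonincreasing n : 0 <= utility X m n.+1 0 ->
  gain X m n.+1 (quote_max X m n.+1) <= gain X m n (quote_max X m n).
Proof.
move=> uS; have /andP[l0 _] := l_range.
have u0 : 0 <= utility X m n 0 by apply: le_trans uS _; exact: utility_anti_state.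
have [maxS_ge0 umaxS] := quote_max_accepted uS.
have [max_ge0 umax] := quote_max_accepted u0.
rewrite !gain_acceptedE // leeB // lee_wpmul2l //.
apply: le_trans (expected_delayS mu_gt0 X_gamma n (quote_max X m n.+1)).
apply: expected_delay_le; last exact: quote_max_nonincreasing.
by rewrite gt_eqF // (lt_le_trans _ maxS_ge0).
Qed.

(** From the state a = [n_under] on, the largest quotes are bounded by the
    finite one at a, while the mean sojourn time diverges. *)
Lemma gain_max_eventually_lt0 : (0 < l)%R ->
  (forall n, 0 <= utility X m n 0) ->
  exists n, gain X m n (quote_max X m n) < 0.
Proof.
move=> l0 u0; have [a aE] := n_under_attained mu_gt0 c_gt0 r_gt0 l_range X_gamma.
have ua : utility X m a +oo < 0 by rewrite -n_under_le // aE.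
have /fineK := quote_max_fin_num ua; set y := fine _ => yE.
exists (maxn a (Num.truncn (mu * (p / l + y)))).
set n := maxn _ _; have [max_ge0 umax] := quote_max_accepted (u0 n).
have [amax_ge0 _] := quote_max_accepted (u0 a).
have y0 : (0 <= y)%R by rewrite -lee_fin yE.
rewrite gain_acceptedE // sube_lt0 //.
have delay_lb : (n.+1%:R / mu - y)%:E <= expected_delay X n (quote_max X m n).
  apply: le_trans (expected_delay_lb mu_gt0 X_gamma n y0) _.
  apply: expected_delay_le; first by rewrite gt_eqF // (lt_le_trans _ max_ge0).
  by rewrite yE quote_max_nonincreasing // leq_maxl.
apply: lt_le_trans (lee_wpmul2l _ delay_lb); last by rewrite lee_fin ltW.
rewrite -EFinM lte_fin mulrC -ltr_pdivrMr // ltrBrDr ltr_pdivlMr // mulrC.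
apply: lt_le_trans (truncnS_gt _) _.
by rewrite ler_nat ltnS leq_maxr.
Qed.

End best_quote.

(** * Optimal cutoff *)

Section optimal_profit.
Context {disp : measure_display} {T : measurableType disp} {R : realType}.
Context (P : probability T R) (X : nat -> {RV P >-> R}) (m : params R).

Local Notation lambda := (arrival_rate m).
Local Notation mu := (service_rate m).
Local Notation c := (waiting_cost m).
Local Notation l := (compensation_rate m).
Local Notation r := (risk_aversion m).
Local Notation rho := (lambda / mu)%R.

Context (lambda_gt0 : (0 < lambda)%R).
Context (mu_gt0 : (0 < mu)%R) (c_gt0 : (0 < c)%R) (r_gt0 : (0 < r)%R).
Context (l_range : (0 <= l <= c)%R).
Context (X_gamma : forall n, gamma_distributed n mu (X n)).

(** A real number, so that the marginal analysis applies; this loses nothing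
    below [n_over], where the gain is finite. *)
Definition best_gain n : R := fine (gain X m n (quote_max X m n)).

Let rho_gt0 : (0 < rho)%R. Proof. exact: divr_gt0. Qed.

Lemma lt_n_overW n k : (k <= n)%N -> n%:R%:E < n_over X m -> k%:R%:E < n_over X m.
Proof. by move=> kn; apply: le_lt_trans; rewrite lee_fin ler_nat. Qed.

Lemma best_gainE n : n%:R%:E < n_over X m ->
  gain X m n (quote_max X m n) = (best_gain n)%:E.
Proof.
by rewrite lt_n_over // => u0; rewrite /best_gain fineK // gain_max_fin_num.
Qed.

Lemma best_gain_nonincreasing n : n.+1%:R%:E < n_over X m ->
  (best_gain n.+1 <= best_gain n)%R.
Proof.
move=> lt_Sn; have lt_n := lt_n_overW (leqnSn n) lt_Sn.
rewrite lt_n_over // in lt_n; rewrite lt_n_over // in lt_Sn.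
apply: fine_le; [exact: gain_max_fin_num|exact: gain_max_fin_num|].
exact: gain_max_nonincreasing.
Qed.

Lemma A_marginal n : n%:R%:E < n_over X m ->
  A X m n = (marginal rho best_gain n)%:E.
Proof.
move=> lt_n; rewrite /A best_gainE // /marginal EFinB !EFinM; congr (_ * _ - _ * _).
  by rewrite sumEFin.
rewrite /revenue -sumEFin; apply: eq_bigr => k _.
by rewrite best_gainE ?EFinM //; apply: lt_n_overW lt_n; exact: ltnW.
Qed.

Lemma q_ge0 n k : (0 <= q m k n)%R.
Proof.
by rewrite divr_ge0 ?exprn_ge0 ?sumr_ge0 ?(ltW rho_gt0) // => i _;
  rewrite exprn_ge0 // ltW.
Qed.

Lemma best_quotes_profit n : n%:R%:E <= n_over X m ->
  lambda%:E * \sum_(k < n) (q m k n)%:E * gain X m k (quote_max X m k) =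
  (lambda * profit_rate rho best_gain n)%:E.
Proof.
move=> le_n; rewrite EFinM; congr (_ * _).
rewrite /profit_rate /revenue mulr_suml -sumEFin; apply: eq_bigr => k _.
rewrite best_gainE; last by apply: lt_le_trans le_n; rewrite lte_fin ltr_nat.
by rewrite -EFinM; congr EFin; rewrite /q mulrAC.
Qed.

Lemma admissible_profit_le n (D : 'I_n.+1 -> \bar R) : admissible X m D ->
  profit X m D <= (lambda * profit_rate rho best_gain n)%:E.
Proof.
move=> [/andP[_ le_n] D0 uD _]; rewrite -best_quotes_profit //.
apply: lee_wpmul2l; first by rewrite lee_fin ltW.
apply: lee_sum => k _; apply: lee_wpmul2l; first by rewrite lee_fin q_ge0.
by apply: gain_accepted_le => //; exact: (uD (widen_ord _ k) (ltn_ord k)).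
Qed.

Lemma profit_quotes_P n eps :
  profit X m (quotes_P X m eps : 'I_n.+1 -> \bar R) =
  lambda%:E * \sum_(k < n) (q m k n)%:E * gain X m k (quote_max X m k).
Proof.
by congr (_ * _); apply: eq_bigr => k _; rewrite /quotes_P /= ltn_ord.
Qed.

Lemma quotes_P_admissible n (eps : R) :
  n_under X m <= n%:R%:E <= n_over X m -> (0 < eps)%R ->
  0 <= quote_max X m n + eps%:E ->
  admissible X m (quotes_P X m eps : 'I_n.+1 -> \bar R).
Proof.
move=> n_range eps0 q0; have /andP[under_n over_n] := n_range.
have acc (k : nat) : (k < n)%N -> quotes_accepted X m k (quote_max X m k).
  move=> kn; apply: quote_max_accepted => //; rewrite -lt_n_over //.
  by apply: lt_le_trans over_n; rewrite lte_fin ltr_nat.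
split=> //.
- by move=> k; rewrite /quotes_P; case: ifPn => // /acc[].
- by move=> k kn; rewrite /quotes_P kn; have [] := acc k kn.
rewrite /quotes_P ltnn ltNge; apply/negP => u0.
have qfin : quote_max X m n \is a fin_num.
  by apply: quote_max_fin_num => //; rewrite -n_under_le //.
have := quote_max_ub q0 u0.
by rewrite leNgt lteDl // lte_fin eps0.
Qed.

Lemma n_tilde_or_over_finite : exists n, mine (n_tilde X m) (n_over X m) = n%:R%:E.
Proof.
have min_nat (x y : \bar R) k : x = k%:R%:E ->
    (exists2 j, True & y = j%:R%:E) \/ y = +oo -> exists n, mine x y = n%:R%:E.
  move=> -> [[j _ ->]|->]; last by exists k; rewrite min_l // leey.
  by case: (leP (k%:R%:E : \bar R) j%:R%:E); [exists k|exists j].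
have tc : (exists2 j, True & n_tilde X m = j%:R%:E) \/ n_tilde X m = +oo.
  by case: (@enat_inf_cases R [set k | k%:R%:E < n_over X m /\ A X m k < 0]);
    [case=> j _ jE; left; exists j|right].
case: (@enat_inf_cases R [set n | utility X m n 0 < 0]) => [[k _ kE]|over_y].
  by rewrite minC; exact: min_nat kE tc.
have over_all n : n%:R%:E < n_over X m by rewrite [ltRHS]over_y ltry.
have u0 n : 0 <= utility X m n 0 by rewrite -lt_n_over.
have /andP[l0 _] := l_range.
(* With l = 0 the utility does not depend on the quote, so the two thresholds
   agree and [n_over] would be finite like [n_under]. *)
have l_gt0 : (0 < l)%R.
  rewrite lt_neqAle l0 andbT; apply/eqP => lE.
  have [a aE] := n_under_attained mu_gt0 c_gt0 r_gt0 l_range X_gamma.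
  have : utility X m a +oo < 0 by rewrite -n_under_le // aE.
  apply/negP; rewrite -leNgt; apply: le_trans (u0 a) _.
  by rewrite /utility -lE; under [in leRHS]eq_fun do rewrite !mul0r;
    under [in leLHS]eq_fun do rewrite !mul0r.
have [n gn] := gain_max_eventually_lt0 mu_gt0 c_gt0 r_gt0 l_range X_gamma l_gt0 u0.
have An : A X m n < 0.
  rewrite A_marginal // lte_fin; apply: (@le_lt_trans _ _ (best_gain n)).
    apply: (marginal_le_gain rho_gt0) => k _.
    exact: best_gain_nonincreasing (over_all k.+1).
  by rewrite -lte_fin -best_gainE.
have : n_tilde X m <= n%:R%:E by apply/le_enat_inf; exists n.
move=> /enat_inf_attained[k _ kE]; apply: (min_nat _ _ k) => //.
by right.
Qed.

Lemma profit_rate_maximal nP n :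
  nP%:R%:E = maxe (n_under X m) (mine (n_tilde X m) (n_over X m)) ->
  n_under X m <= n%:R%:E <= n_over X m ->
  (profit_rate rho best_gain n <= profit_rate rho best_gain nP)%R.
Proof.
move=> nPE /andP[under_n over_n].
apply: profit_rate_le_peak => // k /andP[].
- move=> nk kP; have : k%:R%:E < mine (n_tilde X m) (n_over X m).
    have : k%:R%:E < nP%:R%:E :> \bar R by rewrite lte_fin ltr_nat.
    rewrite nPE lt_max => /orP[|//]; rewrite ltNge => /negP[].
    by apply: le_trans under_n _; rewrite lee_fin ler_nat.
  rewrite lt_min => /andP[k_tilde k_over].
  rewrite -lee_fin -A_marginal // leNgt; apply/negP => Ak.
  by move: k_tilde; rewrite ltNge => /negP[]; apply/le_enat_inf; exists k.
- move=> Pk kn; have k_over : k%:R%:E < n_over X m.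
    by apply: lt_le_trans over_n; rewrite lte_fin ltr_nat.
  have : n_tilde X m <= k%:R%:E.
    have : nP%:R%:E <= k%:R%:E :> \bar R by rewrite lee_fin ler_nat.
    rewrite nPE ge_max ge_min => /andP[_ /orP[//|]].
    by rewrite leNgt k_over.
  move=> /le_enat_inf[j [j_over Aj] jk].
  apply: (@le_trans _ _ (marginal rho best_gain j)).
    apply: (marginal_nonincreasing rho_gt0 jk) => i /andP[ji ik].
    exact: best_gain_nonincreasing (lt_n_overW ik k_over).
  by rewrite -lee_fin -A_marginal // ltW.
Qed.

End optimal_profit.

Theorem theorem1 (disp : measure_display) (T : measurableType disp)
    (R : realType) (P : probability T R) (X : nat -> {RV P >-> R})
    (m : params R)
    (lambda_gt0 : (0 < arrival_rate m)%R)
    (mu_gt0 : (0 < service_rate m)%R)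
    (c_gt0 : (0 < waiting_cost m)%R)
    (r_gt0 : (0 < risk_aversion m)%R)
    (p_range : (0 <= entrance_fee m <= service_value m)%R)
    (l_range : (0 <= compensation_rate m <= waiting_cost m)%R)
    (X_gamma : forall (n : nat) (S : set R), measurable S ->
       distribution P (X n) S = gamma_law n (service_rate m) S) :
  exists nP : nat,
    [/\ nP%:R%:E = maxe (n_under X m) (mine (n_tilde X m) (n_over X m)),
        forall eps : R, (0 < eps)%R -> 0 <= quote_max X m nP + eps%:E ->
          optimal X m (quotes_P X m eps : 'I_nP.+1 -> \bar R)
      & max_profit X m
          ((arrival_rate m)%:E *
           \sum_(n < nP) (q m n nP)%:E * gain X m n (quote_max X m n))].
Proof.
have [a aE] := n_under_attained mu_gt0 c_gt0 r_gt0 l_range X_gamma.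
have [s sE] := n_tilde_or_over_finite lambda_gt0 mu_gt0 c_gt0 r_gt0 l_range X_gamma.
have nPE : (maxn a s)%:R%:E =
    maxe (n_under X m) (mine (n_tilde X m) (n_over X m)).
  rewrite aE sE; case: leqP => as_.
    by rewrite max_r // lee_fin ler_nat.
  by rewrite max_l // lee_fin ler_nat ltnW.
exists (maxn a s); set nP := maxn a s in nPE *.
have nP_range : n_under X m <= nP%:R%:E <= n_over X m.
  rewrite nPE le_max lexx /= ge_max n_under_le_over //=.
  by rewrite ge_min lexx orbT.
have nP_over : nP%:R%:E <= n_over X m by case/andP: nP_range.
have maximal (n1 : nat) (D1 : 'I_n1.+1 -> \bar R) : admissible X m D1 ->
    profit X m D1 <= (arrival_rate m)%:E *
      \sum_(n < nP) (q m n nP)%:E * gain X m n (quote_max X m n).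
  move=> D1adm; rewrite best_quotes_profit //.
  have [n1_range _ _ _] := D1adm.
  have := admissible_profit_le lambda_gt0 mu_gt0 r_gt0 l_range X_gamma D1adm.
  move=> /le_trans; apply; rewrite lee_fin ler_pM2l //.
  exact: profit_rate_maximal nPE n1_range.
(* eps = 1 is always allowed, because [quote_max] is at least -1. *)
have q1 : 0 <= quote_max X m nP + 1%:E.
  have [u0|u0] := leP 0 (utility X m nP 0).
    have [q0 _] := quote_max_accepted r_gt0 l_range u0.
    by rewrite adde_ge0 // lee_fin.
  rewrite /quote_max; case: ifPn => [_|/set0P acc].
    by rewrite -EFinD addNr.
  by move: u0; rewrite ltNge quotes_accepted0.
split=> //.
- move=> eps eps0 qeps; split; first exact: quotes_P_admissible.
  by move=> n1 D1 /maximal; rewrite profit_quotes_P.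
- split=> //; exists nP, (quotes_P X m 1%R); split; last exact: profit_quotes_P.
  exact: quotes_P_admissible.
Qed.
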